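(* Let $p$ be an odd prime, $q$ a prime power with $p\nmid q$, $r>1$, and let $C$ be a cyclic code of length $p^r$ over $\mathbb{F}_q$. Then a Sylow $p$-subgroup of $Per(C)$ has order $p^s$ with $$r\le s\le p^{r-1}+p^{r-2}+\cdots+1.$$ Furthermore, let $t$ be the multiplicative order of $q$ modulo $p$ and let $z$ be the largest integer such that $p^z\mid (q^t-1)$. If $z=1$, then $$2r-1\le s\le p^{r-1}+p^{r-2}+\cdots+1.$$
   Context: For a linear code $C\subseteq\mathbb{F}_q^n$ and $\sigma\in S_n$, put $\sigma(C)=\{(x_{\sigma^{-1}(1)},\ldots,x_{\sigma^{-1}(n)}) : (x_1,\ldots,x_n)\in C\}$. The permutation group of $C$ is $Per(C)=\{\sigma\in S_n : \sigma(C)=C\}$. The code $C$ is cyclic if $T\in Per(C)$, where $T$ is the shift (a complete cycle of length $n$). *)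

(* Defs.v *)
From HB Require Import structures.
From mathcomp Require Import all_boot all_order all_algebra all_fingroup all_solvable.

Set Implicit Arguments.
Unset Strict Implicit.
Unset Printing Implicit Defensive.

Section Codes.

Variables (F : finFieldType) (n : nat).
Implicit Types (C : {vspace 'rV[F]_n}) (s t : 'S_n).

(* Since [col_perm u x] has entries x_(u j), this is the set of all
   (x_(s^-1 j))_j with x in C. *)
Definition perm_code s C : {set 'rV[F]_n} := [set col_perm s^-1%g x | x in C].

Definition Per C : {set 'S_n} := [set s | perm_code s C == [set x in C]].

Lemma PerP C s :
  reflect (forall x, (col_perm s^-1%g x \in C) = (x \in C)) (s \in Per C).
Proof.
rewrite inE; apply: (iffP eqP) => [/setP eqC x | eqC].
  have := eqC (col_perm s^-1%g x); rewrite inE => <-.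
  apply/imsetP/idP => [[y Cy /(congr1 (col_perm s))] | Cx]; last by exists x.
  by rewrite -!col_permM mulgV !col_perm1 => ->.
apply/setP=> x; rewrite inE; apply/imsetP/idP => [[y Cy ->] | Cx].
  by rewrite eqC.
exists (col_perm s x); last by rewrite -col_permM mulVg col_perm1.
by rewrite -eqC -col_permM mulVg col_perm1.
Qed.

Lemma Per_group_set C : group_set (Per C).
Proof.
apply/group_setP; split=> [|s t /PerP Cs /PerP Ct].
  by apply/PerP=> x; rewrite invg1 col_perm1.
by apply/PerP=> x; rewrite invMg col_permM Ct Cs.
Qed.

Canonical Per_group C := Group (Per_group_set C).

(* The complete cycle i |-> i + 1 modulo n. *)
Definition shift : 'S_n := perm (@ordS_inj n).

Definition cyclic_code C : bool := shift \in Per C.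

End Codes.

(* Main.v *)
Require Import Defs.
From mathcomp Require Import all_boot all_order all_algebra all_fingroup all_solvable.
From mathcomp Require Import all_field ring.
Import GRing.Theory.

(** Upper bound: |P| divides (p^r)!, whose p-adic valuation is
    p^(r-1) + ... + 1. Lower bounds: the shift makes Per(C) transitive, so
    |Per(C)| is p^r times the order of the stabilizer of 0. That stabilizer
    contains the multiplier i |-> q i, because g(X)^q = g(X^q) over F_q and C
    is an ideal of F_q[X]/(X^n - 1). If p exactly divides q^t - 1, lifting the
    exponent shows that p^(r-1) divides the order of q modulo p^r, hence the
    order of the multiplier. *)

(** Binomial expansion with everything from degree 3 on collected in [c]. The quadratic term stays
    explicit because its coefficient gains a factor [p] when [m = p] is odd. *)
Lemma expn1D_third_order x m :
  exists c, (1 + x) ^ m = 1 + m * x + 'C(m, 2) * x ^ 2 + c * x ^ 3.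
Proof.
elim: m => [|m [c IHm]]; first by exists 0; rewrite bin0n.
by exists ('C(m, 2) + c + c * x); rewrite expnS IHm binS bin1; ring.
Qed.

Section Lifting.
Variables (p b a : nat).
Hypotheses (p_pr : prime p) (p_odd : odd p) (p'a : ~~ (p %| a)).
Hypothesis b_def : b = 1 + p * a.

Lemma expn_prime_lift k :
  exists2 c, ~~ (p %| c) & b ^ (p ^ k) = 1 + p ^ k.+1 * c.
Proof.
elim: k => [|k [c p'c IHk]]; first by exists a.
have [d Ed] := expn1D_third_order (p ^ k.+1 * c) p.
(* As [p] is odd, 'C(p, 2) = p (p-1)/2, so the quadratic and cubic terms are both divisible by
   p^(k+3). The new cofactor is thus congruent to [c] modulo [p]. *)
exists (c + p * ((p.-1)./2 * p ^ k * c ^ 2 + d * (p ^ k) ^ 2 * c ^ 3)).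
  by rewrite dvdn_addl // dvdn_mulr.
by rewrite expnSr expnM IHk Ed bin2odd // !expnS; ring.
Qed.

(** With [k] the p-adic valuation of [m], that of b^m - 1 is exactly k+1: write m = m' p^k, lift to
    b^(p^k), then expand the m'-th power, whose leading cofactor m' c is prime to [p]. *)
Lemma dvdn_pexp_of_expn_eq1 r m :
  0 < r -> 0 < m -> b ^ m = 1 %[mod p ^ r] -> p ^ r.-1 %| m.
Proof.
move=> r_gt0 m_gt0; rewrite (pfactor_dvdn _ p_pr m_gt0).
rewrite leqNgt => bm1; apply/negP => lt_k.
have [m' p'm' Em] := pfactor_coprime p_pr m_gt0.
set k := logn p m in lt_k Em.
have [c p'c Ec] := expn_prime_lift k.
have [d Ed] := expn1D_third_order (p ^ k.+1 * c) m'.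
move/eqP: bm1; rewrite eqn_mod_dvd; last by rewrite expn_gt0 b_def.
have {}lt_k : k.+2 <= r by rewrite -(prednK r_gt0) ltnS.
move/(dvdn_trans (dvdn_exp2l p lt_k)).
have -> : b ^ m - 1 = p ^ k.+1 *
    (m' * c + p * (p ^ k * ('C(m', 2) * c ^ 2 + d * p ^ k.+1 * c ^ 3))).
  by rewrite Em mulnC expnM Ec Ed -!addnA addKn !expnS; ring.
rewrite expnSr dvdn_pmul2l ?expn_gt0 ?prime_gt0 // dvdn_addl; last exact: dvdn_mulr.
by rewrite Euclid_dvdM // (negPf p'c) orbF; apply/negP; rewrite -prime_coprime.
Qed.
End Lifting.

Lemma logn_fact_exp p r : prime p -> logn p (p ^ r)`! = \sum_(i < r) p ^ i.
Proof.
move=> p_pr; have p_gt1 := prime_gt1 p_pr; rewrite logn_fact //.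
have le_r : r.+1 <= (p ^ r).+1 by rewrite ltnS ltnW // ltn_expl.
(* In Legendre's sum of the p^r %/ p^k, the terms with k > r vanish; the others, reversed, are the
   powers p^i with i < r. *)
rewrite (big_cat_nat (n := r.+1)) //=.
rewrite [X in _ + X]big_nat [X in _ + X]big1 => [|k /andP[lt_rk _]]; last first.
  by rewrite divn_small // ltn_exp2l.
rewrite addn0 big_add1 big_nat_rev big_mkord /=; apply: eq_bigr => i _.
by rewrite add0n subnSK // -expnB ?prime_gt0 ?leq_subr // subKn // ltnW.
Qed.

(** Permuting coordinates is injective and [C] is finite, so inclusion forces equality. *)
Lemma Per_of_stable (F : finFieldType) n (C : {vspace 'rV[F]_n}) (s : 'S_n) :
  (forall x, x \in C -> col_perm s^-1%g x \in C) -> s \in Per C.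
Proof.
move=> sC; rewrite inE /perm_code eqEcard; apply/andP; split.
  by apply/subsetP=> _ /imsetP[x Cx ->]; rewrite inE sC.
rewrite card_imset ?cardsE //; apply: can_inj (col_perm s) _ => x.
by rewrite -col_permM mulgV col_perm1.
Qed.

Section Multiplier.
Variables (n k : nat).
Hypothesis co_nk : coprime n k.

Definition mulmod_ord (i : 'I_n) : 'I_n :=
  Ordinal (ltn_pmod (k * i) (leq_ltn_trans (leq0n i) (ltn_ord i))).

Lemma mulmod_ord_inj : injective mulmod_ord.
Proof.
move=> i j /(congr1 val)/= /eqP.
wlog le_ij : i j / i <= j => [IH|].
  by case/orP: (leq_total i j) => /IH // IHij; rewrite eq_sym => /IHij.
rewrite eq_sym eqn_mod_dvd ?leq_mul2l ?le_ij ?orbT // -mulnBr Gauss_dvdr //.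
move=> n_dv; apply: val_inj; apply/eqP; rewrite eqn_leq le_ij /=.
rewrite -subn_eq0; case: posnP n_dv => // d_gt0 /(dvdn_leq d_gt0).
by rewrite leqNgt (leq_ltn_trans (leq_subr _ _)).
Qed.

Definition multiplier : 'S_n := perm mulmod_ord_inj.

Lemma multiplierX m (i : 'I_n) : (multiplier ^+ m)%g i = k ^ m * i %% n :> nat.
Proof.
elim: m => [|m IHm]; first by rewrite perm1 mul1n modn_small.
by rewrite expgSr permM permE /= IHm modnMmr mulnA -expnS.
Qed.

End Multiplier.

Lemma shiftX n m (i : 'I_n) : (shift n ^+ m)%g i = (i + m) %% n :> nat.
Proof.
elim: m => [|m IHm]; first by rewrite perm1 addn0 modn_small.
by rewrite expgSr permM permE /= IHm -addn1 modnDml addn1 addnS.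
Qed.

Section Cyclic.
Variables (F : finFieldType) (n : nat) (C : {vspace 'rV[F]_n.+1}).
Hypothesis cycC : cyclic_code C.
Local Open Scope ring_scope.
Let S : 'M[F]_n.+1 := perm_mx (shift n.+1).

Lemma cyclic_code_horner (h : {poly F}) (x : 'rV_n.+1) :
  x \in C -> x *m horner_mx S h \in C.
Proof.
move=> Cx; elim/poly_ind: h => [|h c IHh]; first by rewrite rmorph0 mulmx0 rpred0.
rewrite rmorphD rmorphM /= horner_mx_X horner_mx_C mulmxDr mul_mx_scalar.
rewrite rpredD ?rpredZ // mulmxA.
by have /PerP/(_ (x *m horner_mx S h)) := cycC; rewrite col_permE invgK IHh => ->.
Qed.

Lemma delta_perm_mx (s : 'S_n.+1) i : 'e_i *m perm_mx s = 'e_(s i) :> 'rV[F]_n.+1.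
Proof. by rewrite -rowE; apply/rowP=> j; rewrite !mxE eqxx eq_sym. Qed.

Lemma delta_shift_mxX m : 'e_0 *m S ^+ m = 'e_(inZp m) :> 'rV[F]_n.+1.
Proof.
have -> : S ^+ m = perm_mx (shift n.+1 ^+ m)%g.
  by elim: m => [|m IHm]; rewrite ?perm_mx1 // expgSr perm_mxM exprSr IHm.
by rewrite delta_perm_mx; congr ('e_ _); apply: val_inj => /=; rewrite shiftX.
Qed.

(** Evaluation at [S] applied to 'e_0 identifies F[X]/(X^n - 1), for length n, with row vectors. The
    exponents [e] are arbitrary in order to cover both h(X) and h(X^q). *)
Lemma delta_horner_shift_mx (x : 'rV[F]_n.+1) (e : 'I_n.+1 -> nat) :
  'e_0 *m horner_mx S (\sum_i x 0 i *: 'X^(e i)) =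
    \sum_i x 0 i *: 'e_(inZp (e i)) :> 'rV[F]_n.+1.
Proof.
rewrite linear_sum mulmx_sumr; apply: eq_bigr => i _.
by rewrite linearZ /= rmorphXn /= horner_mx_X -scalemxAr delta_shift_mxX.
Qed.

Lemma pnat_pchar_poly_card : [pchar {poly F}].-nat #|F|.
Proof.
have [l l_pr charFl] := finPcharP F.
have /and3P[lF _ _] := fin_ring_pchar_abelem charFl.
move: lF; rewrite /pgroup cardsT; apply: sub_in_pnat => l' _ /eqP->.
by rewrite pchar_poly.
Qed.

(* With S the shift matrix and x = e_0 h(S), the vector e_0 h(S)^q = e_0 h(S^q)
   is the image of x under i |-> q i; it is also x h(S)^(q-1), which is in C. *)
Lemma multiplier_Per (co_nq : coprime n.+1 #|F|) : multiplier _ _ co_nq \in Per C.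
Proof.
apply: Per_of_stable => x Cx; rewrite col_permE invgK.
pose h : {poly F} := \sum_i x 0 i *: 'X^i.
have hS : 'e_0 *m horner_mx S h = x.
  rewrite delta_horner_shift_mx [RHS]row_sum_delta.
  by apply: eq_bigr => i _; rewrite valZpK.
have F_gt0 : (0 < #|F|)%N by apply/card_gt0P; exists 0.
(* The q-th power is additive in characteristic dividing q, and it fixes the coefficients, which lie
   in [F]. *)
have hq : h ^+ #|F| = \sum_i x 0 i *: 'X^(#|F| * i).
  rewrite (big_morph (fun g => g ^+ #|F|) (id1 := 0) (op1 := +%R)).
  - by apply: eq_bigr => i _; rewrite exprZn expf_card -exprM mulnC.
  - by move=> f g; rewrite exprDn_pchar ?pnat_pchar_poly_card.
  by rewrite expr0n -(prednK F_gt0).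
suff -> : x *m perm_mx (multiplier _ _ co_nq) = x *m horner_mx S (h ^+ #|F|.-1).
  exact: cyclic_code_horner.
rewrite -[in RHS]hS -mulmxA mulmxE -rmorphM -exprS prednK //.
rewrite hq delta_horner_shift_mx [in LHS](row_sum_delta x) mulmx_suml.
apply: eq_bigr => i _; rewrite -scalemxAl delta_perm_mx permE.
by congr (_ *: 'e_ _); apply: val_inj.
Qed.
End Cyclic.

Lemma Per_cyclic_index (F : finFieldType) n (C : {vspace 'rV[F]_n.+1}) :
  cyclic_code C -> #|Per C : 'C_(Per C)[ord0 | 'P]|%g = n.+1.
Proof.
move=> cycC; rewrite -card_orbit -[RHS]card_ord; apply: eq_card => i.
rewrite inE; apply/orbitP; exists (shift n.+1 ^+ i)%g; first exact: groupX.
(* The i-th power of the shift sends 0 to [i], so the orbit of 0 is everything. *)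
by rewrite /= apermE; apply: val_inj => /=; rewrite shiftX add0n modn_small.
Qed.

Lemma dvdn_card_Per_multiplier (F : finFieldType) n (C : {vspace 'rV[F]_n})
    (co_nq : coprime n #|F|) :
  0 < n -> cyclic_code C -> n * #[multiplier _ _ co_nq]%g %| #|Per C|.
Proof.
case: n C co_nq => // n C co_nq _ cycC.
rewrite -(Lagrange (subsetIl (Per C) 'C[ord0 | 'P]%g)) Per_cyclic_index //.
rewrite mulnC dvdn_pmul2r // order_dvdG // inE multiplier_Per //.
apply/astab1P; rewrite /= apermE permE; apply: val_inj.
by rewrite /= muln0 mod0n.
Qed.

(** Evaluate the trivial power of the multiplier at the point 1, which exists since n > 1. *)
Lemma expn_order_multiplier n k (co_nk : coprime n k) :
  1 < n -> k ^ #[multiplier n k co_nk]%g = 1 %[mod n].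
Proof.
move=> n_gt1; have := multiplierX n k co_nk #[multiplier n k co_nk]%g (Ordinal n_gt1).
by rewrite expg_order perm1 muln1 (modn_small n_gt1).
Qed.

Theorem theorem14 (p q r : nat) (F : finFieldType)
    (C : {vspace 'rV[F]_(p ^ r)}) (P : {group 'S_(p ^ r)}) :
  prime p -> odd p -> #|F| = q -> ~~ (p %| q) -> 1 < r ->
  cyclic_code C -> (p.-Sylow(Per C) P)%g ->
  exists s : nat,
    [/\ #|P| = p ^ s,
        r <= s <= \sum_(i < r) p ^ i
      & forall (u : {unit 'F_p}) (t z : nat),
          val u = (q%:R)%R -> t = #[u]%g ->
          p ^ z %| q ^ t - 1 ->
          (forall k, p ^ k %| q ^ t - 1 -> k <= z) ->
          z = 1 ->
          2 * r - 1 <= s <= \sum_(i < r) p ^ i].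
Proof.
move=> p_pr p_odd <- p'q r_gt1 cycC sylP.
have p_gt1 := prime_gt1 p_pr; have r_gt0 := ltnW r_gt1.
have n_gt0 : 0 < p ^ r by rewrite expn_gt0 prime_gt0.
have cP : #|P| = p ^ logn p #|Per C| by rewrite (card_Hall sylP) p_part.
have s_le : logn p #|Per C| <= \sum_(i < r) p ^ i.
  rewrite -logn_fact_exp // dvdn_leq_log ?fact_gt0 //.
  by have := cardSg (subsetT (Per C)); rewrite cardsT card_Sn.
have co_nq : coprime (p ^ r) #|F| by rewrite coprimeXl // prime_coprime.
have dv_mul := dvdn_card_Per_multiplier F _ C co_nq n_gt0 cycC.
exists (logn p #|Per C|); split=> //.
  rewrite s_le andbT -pfactor_dvdn ?cardG_gt0 //.
  exact: dvdn_trans (dvdn_mulr _ _) dv_mul.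
move=> u t z _ _ p_dv z_max z1; subst z; rewrite s_le andbT.
rewrite -pfactor_dvdn ?cardG_gt0 //; apply: dvdn_trans dv_mul.
(* The factor p^r is the orbit length; p^(r-1) has to come from the order of the multiplier. *)
have -> : 2 * r - 1 = r + r.-1 by rewrite mul2n -addnn -subn1 addnBA.
rewrite expnD dvdn_mul //.
have qt_gt0 : 0 < #|F| ^ t.
  by rewrite expn_gt0; apply/orP; left; apply/card_gt0P; exists 0%R.
have [a Ea] := dvdnP p_dv.
have Eb : #|F| ^ t = 1 + p * a by rewrite -(subnKC qt_gt0) Ea expn1 mulnC.
have p'a : ~~ (p %| a).
  (* If [p] divided [a], then p^2 would divide q^t - 1, against z = 1. *)
  apply/negP=> p_a; have := z_max 2; rewrite Ea mulnC expn1 expnS expn1.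
  by rewrite dvdn_mul // => /(_ isT).
apply: (dvdn_pexp_of_expn_eq1 _ _ _ p_pr p_odd p'a Eb) => //.
(* With [m] the order of the multiplier, (q^t)^m = (q^m)^t is 1 modulo p^r. *)
rewrite -expnM mulnC expnM -modnXm expn_order_multiplier ?modnXm ?exp1n //.
by rewrite -(exp1n r) ltn_exp2r.
Qed.
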